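(* Let $P$ be a transition kernel on a space with countably generated $\sigma$-algebra, reversible with respect to a probability measure $\mu$ and nonnegative definite (i.e. $(Pf,f)_\mu\ge0$ for all $f\in L_2(\mu)$). Let $\{A_1,\dots,A_J\}$ be a partition of the state space with $\mu(A_j)>0$ for all $j$. Then $$\tfrac12\,\mathrm{Gap}(\bar P)\min_{j=1,\dots,J}\mathrm{Gap}(P|_{A_j})\;\le\;\mathrm{Gap}(P)\;\le\;\mathrm{Gap}(\bar P).$$
   Context: Spectral gap of a $\mu$-reversible kernel: $\mathrm{Gap}(P)=\inf\{(f,(I-P)f)_\mu/\mathrm{Var}_\mu(f): f\in L_2(\mu),\ \mathrm{Var}_\mu(f)>0\}$, with $(f,g)_\mu=\int fg\,d\mu$. Restriction: $P|_A(x,B)=P(x,B)+\mathbf{1}_B(x)P(x,A^c)$ for $x\in A$, $B\subset A$, which is reversible w.r.t. $\mu$ restricted and normalized to $A$. Projection matrix: $\bar P(i,j)=\frac{1}{\mu(A_i)}\int_{A_i}\int_{A_j}P(x,dy)\mu(dx)$ on $\{1,\dots,J\}$, reversible w.r.t. $(\mu(A_j))_j$.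
   Formalization: The formal theorem also assumes J ≥ 2 and that at least one Gap(P|_{A_j}) is finite (some A_j carries a non-constant L_2 function); otherwise Gap(P̄) or the minimum is an infimum over the empty set, +∞, and the lower bound fails. *)

(* Defs.v *)
From HB Require Import structures.
From mathcomp Require Import all_boot all_order all_algebra.
From mathcomp Require Import all_classical all_reals all_analysis.
Set Implicit Arguments. Unset Strict Implicit. Unset Printing Implicit Defensive.
Import Order.TTheory GRing.Theory Num.Theory.
Import numFieldNormedType.Exports.
Local Open Scope classical_set_scope.
Local Open Scope ring_scope.

Section Spectral.
Context d (T : measurableType d) (R : realType).

Definition countably_generated : Prop :=
  exists G : nat -> set T, (forall n, measurable (G n)) /\
    <<s range G >> = @measurable d T.

Definition L2 (nu : {measure set T -> \bar R}) (f : T -> R) : Prop :=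
  measurable_fun setT f /\ nu.-integrable setT (fun x => (f x ^+ 2)%:E).

Definition ip (nu : {measure set T -> \bar R}) (f g : T -> R) : R :=
  Rintegral nu setT (fun x => f x * g x).

Definition Kop (Q : T -> {measure set T -> \bar R}) (f : T -> R) : T -> R :=
  fun x => Rintegral (Q x) setT f.

Definition Var (nu : {measure set T -> \bar R}) (f : T -> R) : R :=
  ip nu f f - (Rintegral nu setT f) ^+ 2.

Definition Dir (nu : {measure set T -> \bar R}) (Q : T -> {measure set T -> \bar R})
  (f : T -> R) : R := ip nu f f - ip nu f (Kop Q f).

(** Gap(Q) = inf { (f,(I-Q)f)_nu / Var_nu(f) : f in L_2(nu), Var_nu(f) > 0 }
    (an extended real; the infimum of the empty set is +oo). *)
Definition Gap (nu : {measure set T -> \bar R}) (Q : T -> {measure set T -> \bar R})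
  : \bar R :=
  ereal_inf [set ((Dir nu Q f / Var nu f)%:E) | f in [set f | L2 nu f /\ 0 < Var nu f]].

Definition mu_restr (mu : {measure set T -> \bar R}) (A : set T) (mA : measurable A)
  : {measure set T -> \bar R} :=
  mscale ((`|fine (mu A)|)^-1)%:nng (mrestr mu mA).

(** Restricted kernel P|_A(x,B) = P(x, B /\ A) + 1_B(x) P(x, A^c)
    (for x in A, B subset A; the values outside A are irrelevant since the
    restricted measure is concentrated on A). *)
Definition P_restr (P : T -> {measure set T -> \bar R}) (A : set T) (mA : measurable A)
  (x : T) : {measure set T -> \bar R} :=
  measure_add (mrestr (P x) mA) (mscale (`|fine (P x (~` A))|)%:nng (\d_x)).

Definition Pbar (mu : {measure set T -> \bar R}) (P : T -> {measure set T -> \bar R})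
  (J : nat) (A : 'I_J -> set T) (i j : 'I_J) : R :=
  fine (\int[mu]_(x in A i) P x (A j)) / fine (mu (A i)).

End Spectral.

Section FinGap.
Context (R : realType) (J : nat).

Definition VarF (pi : 'I_J -> R) (g : 'I_J -> R) : R :=
  \sum_i pi i * g i ^+ 2 - (\sum_i pi i * g i) ^+ 2.

Definition DirF (pi : 'I_J -> R) (Q : 'I_J -> 'I_J -> R) (g : 'I_J -> R) : R :=
  \sum_i pi i * g i ^+ 2 - \sum_i \sum_j pi i * Q i j * g i * g j.

Definition GapF (pi : 'I_J -> R) (Q : 'I_J -> 'I_J -> R) : \bar R :=
  ereal_inf [set ((DirF pi Q g / VarF pi g)%:E) | g in [set g | 0 < VarF pi g]].

End FinGap.

(* Main.v *)
(** Write Pi f for the average of f over the blocks, extended as a step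
    function.  Step functions realise every test function of the projected
    chain, which gives Gap P <= Gap Pbar and (h, P h) <= (1 - Gap Pbar) (h, h)
    for mean-zero step functions h.  Dropping the jumps between distinct blocks
    from the Dirichlet form gives min Gap(P|A_j) * ||f - Pi f||^2 <= (f, (I-P) f).

    Let c = Gap P, b = 1 - c, m = min Gap(P|A_j), l = Gap Pbar, and let f be a
    unit mean-zero function that almost attains c.  Both b - P (on mean-zero
    functions) and P are nonnegative.  As (f, (b - P) f) is nearly 0, the first
    form nearly annihilates f, so b ||Pi f||^2 is close to (f, P Pi f), and
    Cauchy-Schwarz for the second form bounds this, giving
    b ||Pi f||^2 <= 1 - l up to a small error.  With c >= m (1 - ||Pi f||^2) this
    yields b c >= m (b - (1 - l)) = m (l - c), that is m l <= c (b + m) <= 2 c. *)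
Require Import Defs.
From HB Require Import structures.
From mathcomp Require Import all_boot all_order all_algebra.
From mathcomp Require Import all_classical all_reals all_analysis.
From mathcomp Require Import measurable_realfun.
From mathcomp Require Import ring lra.
Set Implicit Arguments. Unset Strict Implicit. Unset Printing Implicit Defensive.
Import Order.TTheory GRing.Theory Num.Theory.
Import numFieldNormedType.Exports.
Local Open Scope classical_set_scope.
Local Open Scope ring_scope.

Section integral_restricted_measure.
Context d (T : measurableType d) (R : realType).
Implicit Types (m : {measure set T -> \bar R}) (A : set T).

Lemma ge0_integral_mrestr m A (mA : measurable A) (f : T -> \bar R) :
  measurable_fun setT f -> (forall x, (0 <= f x)%E) ->
  (\int[mrestr m mA]_x f x = \int[m]_(x in A) f x)%E.
Proof.
move=> mf f0; have mAC := measurableC mA.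
rewrite -(setUv A) ge0_integral_setU//; last 2 first.
- exact: measurable_funS mf.
- by apply/disj_setPS; rewrite setICr.
rewrite [X in (_ + X)%E](null_set_integral mAC); last 2 first.
- exact: measurable_funS mf.
- by rewrite /= /mrestr setICl measure0.
rewrite adde0; apply: eq_measure_integral => B mB BA.
by rewrite /= /mrestr (setIidl BA).
Qed.

Lemma integrable_mrestr m A (mA : measurable A) (f : T -> \bar R) :
  measurable_fun setT f -> m.-integrable A f ->
  (mrestr m mA).-integrable setT f.
Proof.
move=> mf /integrableP[_ foo]; apply/integrableP; split=> //.
by rewrite ge0_integral_mrestr//; exact: measurableT_comp.
Qed.

Lemma integrable_mscale m (k : {nonneg R}) (f : T -> \bar R) :
  m.-integrable setT f -> (mscale k m).-integrable setT f.
Proof.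
move=> /integrableP[mf foo]; apply/integrableP; split=> //.
rewrite ge0_integral_mscale//; last exact: measurableT_comp.
by rewrite lte_mul_pinfty// lee_fin.
Qed.

Lemma integral_mscale m (k : {nonneg R}) (f : T -> \bar R) :
  m.-integrable setT f ->
  (\int[mscale k m]_x f x = k%:num%:E * \int[m]_x f x)%E.
Proof.
move=> fi; have mf := measurable_int _ fi.
rewrite [LHS]integralE ge0_integral_mscale//; last exact: measurable_funepos.
rewrite ge0_integral_mscale//; last exact: measurable_funeneg. 
rewrite [X in _ = (_ * X)%E]integralE [RHS]muleBr//.
by apply: fin_num_adde_defr; exact: integrable_pos_fin_num.
Qed.

Lemma integral_mrestr m A (mA : measurable A) (f : T -> \bar R) :
  measurable_fun setT f ->
  (\int[mrestr m mA]_x f x = \int[m]_(x in A) f x)%E.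
Proof.
move=> mf; rewrite [LHS]integralE [RHS]integralE.
by rewrite !ge0_integral_mrestr//; [exact: measurable_funeneg|exact: measurable_funepos].
Qed.

Lemma Rintegral_mu_restr m A (mA : measurable A) (f : T -> R) :
  measurable_fun setT f -> m.-integrable A (EFin \o f) ->
  Rintegral (mu_restr m mA) setT f =
  `|fine (m A)|^-1 * Rintegral m A f.
Proof.
move=> mf fi; have mEf : measurable_fun setT (EFin \o f) by exact/measurable_EFinP.
rewrite /Rintegral /mu_restr integral_mscale; last exact: integrable_mrestr.
by rewrite integral_mrestr// fineM//; exact: integrable_fin_num.
Qed.

End integral_restricted_measure.

Section kernel_operator.
Context d (T : measurableType d) (R : realType).

Lemma measurable_Kop (Q : T -> {measure set T -> \bar R}) (f : T -> R) :
  (forall U, measurable U -> measurable_fun setT (Q ^~ U)) ->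
  measurable_fun setT f -> measurable_fun setT (Kop Q f).
Proof.
move=> mQ /measurable_EFinP mf; rewrite /Kop /Rintegral.
apply: measurableT_comp => //.
rewrite (_ : (fun _ => _) = (fun x => \int[Q x]_y (EFin \o f)^\+ y -
  \int[Q x]_y (EFin \o f)^\- y)%E); last first.
  by apply/funext => x; rewrite integralE.
apply: emeasurable_funB; apply: measurable_fun_integral_kernel => //.
- exact: measurable_funepos.
- exact: measurable_funeneg.
Qed.

Lemma measurable_P_restr (P : R.-pker T ~> T) (A : set T) (mA : measurable A) U :
  measurable U -> measurable_fun setT (fun x => P_restr P mA x U).
Proof.
move=> mU; rewrite (_ : (fun x => _) = fun x =>
  (P x (U `&` A) + `|fine (P x (~` A))|%:E * (\1_U x)%:E)%E); last first.
  by apply/funext => x; rewrite [LHS]measure_addE.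
apply: emeasurable_funD; first exact/measurable_kernel/measurableI.
apply: emeasurable_funM; last exact/measurable_EFinP.
apply/measurable_EFinP; apply: measurableT_comp => //; apply: measurableT_comp => //.
by apply: measurable_kernel; exact: measurableC.
Qed.

Lemma Kop_P_restr (P : R.-pker T ~> T) (A : set T) (mA : measurable A) (f : T -> R) x :
  measurable_fun setT f -> (P x).-integrable setT (EFin \o f) ->
  Kop (P_restr P mA) f x = Rintegral (P x) A f + fine (P x (~` A)) * f x.
Proof.
move=> mf fi; have mEf : measurable_fun setT (EFin \o f) by exact/measurable_EFinP.
have fiA : (P x).-integrable A (EFin \o f) by exact: integrableS fi.
have di : (\d_x : {measure set T -> \bar R}).-integrable setT (EFin \o f).
  apply/integrableP; split=> //; rewrite integral_dirac//; last first.
    exact: measurableT_comp.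
  by rewrite diracT mul1e ltry.
rewrite /Kop /Rintegral /P_restr integral_measure_add//; last 2 first.
- exact: integrable_mrestr.
- exact: integrable_mscale.
rewrite integral_mrestr// integral_mscale// integral_dirac// diracT mul1e.
rewrite fineD//=; last exact: integrable_fin_num.
by rewrite ger0_norm// fine_ge0.
Qed.

End kernel_operator.

Section joint_law.
Context d (T : measurableType d) (R : realType).
Variables (mu : probability T R) (P : R.-pker T ~> T).

Let start : R.-pker unit ~> T :=
  kprobability (measurable_cst (mu : pprobability T R)).

Let measurable_last_two : measurable_fun setT (fun z : (unit * T) * T => (z.1.2, z.2)).
Proof. by apply: measurable_fun_pair => //; apply: measurableT_comp. Qed.

Let step : R.-sfker (unit * T) ~> T := kernel.kernel_snd P.
Let record : R.-sfker ((unit * T) * T) ~> (T * T)%type := kdirac measurable_last_two.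
Let step_record : R.-sfker (unit * T) ~> (T * T)%type := mkcomp step record.

(* The law of (x, y) with x ~ mu and y ~ P x. *)
Definition joint : {measure set (T * T) -> \bar R} := mkcomp start step_record tt.

Lemma ge0_integral_joint (F : T * T -> \bar R) :
  measurable_fun setT F -> (forall z, (0 <= F z)%E) ->
  (\int[joint]_z F z = \int[mu]_x \int[P x]_y F (x, y))%E.
Proof.
move=> mF F0; rewrite /joint.
rewrite (integral_kcomp start step_record)//; apply: eq_integral => x _.
rewrite (integral_kcomp step record)//; apply: eq_integral => y _.
by rewrite /record /= integral_dirac// diracT mul1e.
Qed.


Lemma joint_setX (B C : set T) : measurable B -> measurable C ->
  joint (B `*` C) = (\int[mu]_(x in B) P x C)%E.
Proof.
move=> mB mC; have mBC : measurable (B `*` C) by exact: measurableX.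
rewrite -(setIT (B `*` C)) -integral_indic// ge0_integral_joint//; last exact/measurable_EFinP/measurable_indic.
rewrite [RHS]integral_mkcond; apply: eq_integral => x _.
rewrite patchE; case: ifPn => xB.
  rewrite -[in RHS](setIT C) -integral_indic//; apply: eq_integral => y _.
  by rewrite !indicE in_setX xB.
by apply: integral0_eq => y _; rewrite indicE in_setX (negbTE xB).
Qed.

Lemma ge0_integral_joint_fst (F : T -> \bar R) :
  measurable_fun setT F -> (forall x, (0 <= F x)%E) ->
  (\int[joint]_z F z.1 = \int[mu]_x F x)%E.
Proof.
move=> mF F0; rewrite ge0_integral_joint//; last exact: measurableT_comp.
apply: eq_integral => x _ /=.
by rewrite integral_cst// prob_kernel mule1.
Qed.

Lemma integrable_joint_fst (F : T -> \bar R) :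
  mu.-integrable setT F -> joint.-integrable setT (fun z => F z.1).
Proof.
move=> /integrableP[mF Foo]; apply/integrableP; split; first exact: measurableT_comp.
rewrite (ge0_integral_joint_fst (F := fun x => `|F x|%E))//.
exact: measurableT_comp.
Qed.

Lemma integral_joint_fst (F : T -> \bar R) : measurable_fun setT F ->
  (\int[joint]_z F z.1 = \int[mu]_x F x)%E.
Proof.
move=> mF; rewrite [LHS]integralE [RHS]integralE; congr (_ - _)%E.
  rewrite -ge0_integral_joint_fst//; last exact: measurable_funepos.
  by apply: eq_integral => z _; rewrite !funeposE.
rewrite -ge0_integral_joint_fst//; last exact: measurable_funeneg.
by apply: eq_integral => z _; rewrite !funenegE.
Qed.

Lemma integrable_inner (F : T * T -> \bar R) :
  joint.-integrable setT F ->
  {ae mu, forall x, (P x).-integrable setT (fun y => F (x, y))}.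
Proof.
move=> /integrableP[mF].
have mabs : measurable_fun setT (fun z => `|F z|%E) by exact: measurableT_comp.
rewrite ge0_integral_joint// => Foo.
have mI : measurable_fun setT (fun x => \int[P x]_y `|F (x, y)|)%E.
  exact: (measurable_fun_integral_finite_kernel (fun z => `|F z|%E)).
have /integrable_ae : mu.-integrable setT (fun x => \int[P x]_y `|F (x, y)|)%E.
  apply/integrableP; split=> //.
  by under eq_integral do rewrite gee0_abs ?integral_ge0//.
move=> /(_ measurableT); apply: filterS => x /(_ I) fin; apply/integrableP; split.
  exact: measurable_fun_pair2.
by rewrite ltey_eq fin.
Qed.

Lemma integrable_Rintegral_inner (F : T * T -> R) :
  joint.-integrable setT (EFin \o F) ->
  mu.-integrable setT (fun x => (Rintegral (P x) setT (fun y => F (x, y)))%:E).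
Proof.
move=> /integrableP[mF Foo].
have mabs : measurable_fun setT (fun z => `|(F z)%:E|%E) by exact: measurableT_comp.
have mI : measurable_fun setT (fun x => \int[P x]_y `|(F (x, y))%:E|)%E.
  exact: (measurable_fun_integral_finite_kernel (fun z => `|(F z)%:E|%E)).
apply: (@le_integrable _ _ _ _ _ _ _ (fun x => \int[P x]_y `|(F (x, y))%:E|)%E) => //.
- apply/measurable_EFinP; apply: measurableT_comp => //.
  rewrite (_ : (fun _ => _) = (fun x => \int[P x]_y (EFin \o F)^\+ (x, y) -
    \int[P x]_y (EFin \o F)^\- (x, y))%E); last first.
    apply/funext => x; rewrite integralE; congr (_ - _)%E; apply: eq_integral => y _.
      by rewrite !funeposE.
    by rewrite !funenegE.
  apply: emeasurable_funB.
    apply: (measurable_fun_integral_finite_kernel ((EFin \o F)^\+)%E) => //.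
    exact: measurable_funepos.
  apply: (measurable_fun_integral_finite_kernel ((EFin \o F)^\-)%E) => //.
  exact: measurable_funeneg.
- move=> x _; rewrite [leRHS]gee0_abs ?integral_ge0//.
  have mFx : measurable_fun setT (fun y => (F (x, y))%:E).
    exact: (measurableT_comp mF (pair1_measurable x)).
  apply: le_trans (le_abse_integral _ _ mFx) => //.
  by rewrite /Rintegral; case: (\int[P x]_y (F (x, y))%:E)%E => //=; rewrite normr0 leey.
- apply/integrableP; split=> //; under eq_integral do rewrite gee0_abs ?integral_ge0//.
  by rewrite -(ge0_integral_joint (F := fun z => `|(F z)%:E|%E)).
Qed.

Lemma Rintegral_joint (F : T * T -> R) :
  joint.-integrable setT (EFin \o F) ->
  Rintegral joint setT F =
  Rintegral mu setT (fun x => Rintegral (P x) setT (fun y => F (x, y))).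
Proof.
move=> Fi; have mF := measurable_int _ Fi.
pose p x := (\int[P x]_y (EFin \o F)^\+ (x, y))%E.
pose n x := (\int[P x]_y (EFin \o F)^\- (x, y))%E.
have mp : measurable_fun setT p.
  apply: (measurable_fun_integral_finite_kernel ((EFin \o F)^\+)%E) => //.
  exact: measurable_funepos.
have mn : measurable_fun setT n.
  apply: (measurable_fun_integral_finite_kernel ((EFin \o F)^\-)%E) => //.
  exact: measurable_funeneg.
have pi : mu.-integrable setT p.
  apply/integrableP; split=> //.
  under eq_integral do rewrite gee0_abs ?integral_ge0//.
  rewrite -ge0_integral_joint//; last exact: measurable_funepos.
  by apply: integrable_lty => //; exact: integrable_funepos.
have ni : mu.-integrable setT n.
  apply/integrableP; split=> //.
  under eq_integral do rewrite gee0_abs ?integral_ge0//.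
  rewrite -ge0_integral_joint//; last exact: measurable_funeneg.
  by apply: integrable_lty => //; exact: integrable_funeneg.
rewrite /Rintegral [X in fine X]integralE.
rewrite ge0_integral_joint//; last exact: measurable_funepos.
rewrite ge0_integral_joint//; last exact: measurable_funeneg.
rewrite -integralB//; congr fine; apply: ae_eq_integral => //.
- exact: emeasurable_funB.
- exact: measurable_int (integrable_Rintegral_inner Fi).
- apply: filterS (integrable_inner Fi) => x Fxi _.
  rewrite fineK; last exact: (integrable_fin_num _ Fxi).
  rewrite [RHS]integralE; congr (_ - _)%E; apply: eq_integral => y _.
    by rewrite !funeposE.
  by rewrite !funenegE.
Qed.

End joint_law.

Section square_integrable.
Context d (T : measurableType d) (R : realType).
Variable nu : {measure set T -> \bar R}.
Implicit Types f g u : T -> R.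

Lemma L2M_integrable f g : L2 nu f -> L2 nu g ->
  nu.-integrable setT (fun x => (f x * g x)%:E).
Proof.
move=> [mf f2] [mg g2].
apply: (le_integrable _ _ _ (integrableD _ f2 g2)) => //.
  by apply/measurable_EFinP; exact: measurable_funM.
move=> x _; rewrite -EFinD !abse_EFin lee_fin.
by rewrite [leRHS]ger0_norm ?addr_ge0 ?sqr_ge0// ler_norml; apply/andP; split; nra.
Qed.

Lemma L2D f g (a b : R) : L2 nu f -> L2 nu g ->
  L2 nu (fun x => a * f x + b * g x).
Proof.
move=> Lf Lg; have [mf f2] := Lf; have [mg g2] := Lg; split.
  by apply: measurable_funD; apply: measurable_funM.
rewrite (_ : (fun x => _) = (fun x => (a ^+ 2)%:E * (f x ^+ 2)%:E +
   ((2 * a * b)%:E * (f x * g x)%:E + (b ^+ 2)%:E * (g x ^+ 2)%:E))%E).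
  apply: integrableD => //; first exact: integrableZl.
  apply: integrableD => //; apply: integrableZl => //; exact: L2M_integrable.
by apply/funext => x; rewrite -!EFinM -!EFinD; congr (_%:E); ring.
Qed.

Lemma L2M_indic f (A : set T) : measurable A -> L2 nu f ->
  L2 nu (fun x => f x * \1_A x).
Proof.
move=> mA [mf f2]; split; first by apply: measurable_funM.
apply: (le_integrable _ _ _ f2) => //.
  by apply/measurable_EFinP; apply: measurable_funX; apply: measurable_funM.
move=> x _; rewrite !abse_EFin lee_fin !ger0_norm ?sqr_ge0//.
by rewrite exprMn indicE; case: (x \in A); rewrite ?expr1n ?mulr1// expr0n mulr0 sqr_ge0.
Qed.

Lemma ipC f g : ip nu f g = ip nu g f.
Proof. by apply: eq_Rintegral => x _; rewrite mulrC. Qed.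

Lemma ipDl f g u (a b : R) : L2 nu f -> L2 nu g -> L2 nu u ->
  ip nu (fun x => a * f x + b * g x) u = a * ip nu f u + b * ip nu g u.
Proof.
move=> Lf Lg Lu; rewrite /ip.
have fui := L2M_integrable Lf Lu; have gui := L2M_integrable Lg Lu.
rewrite -!RintegralZl// -RintegralD//.
- by apply: eq_Rintegral => x _; rewrite mulrDl !mulrA.
- exact: (integrableZl _ a fui).
- exact: (integrableZl _ b gui).
Qed.

Lemma ipDr f g u (a b : R) : L2 nu f -> L2 nu g -> L2 nu u ->
  ip nu u (fun x => a * f x + b * g x) = a * ip nu u f + b * ip nu u g.
Proof. by move=> Lf Lg Lu; rewrite ipC ipDl// ![ip nu u _]ipC. Qed.

Lemma ip_sqD f g (a b : R) : L2 nu f -> L2 nu g ->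
  let u x := a * f x + b * g x in
  ip nu u u = a ^+ 2 * ip nu f f + 2 * a * b * ip nu f g + b ^+ 2 * ip nu g g.
Proof.
move=> Lf Lg u; rewrite /u ipDl//; last exact: L2D.
by rewrite !ipDr// [ip nu g f]ipC; ring.
Qed.

Lemma Rintegral_indicM (A : set T) f : measurable A ->
  Rintegral nu A f = Rintegral nu setT (fun x => f x * \1_A x).
Proof.
move=> mA; rewrite Rintegral_mkcond; apply: eq_Rintegral => x _.
by rewrite patch_indic.
Qed.

Lemma Rintegral_sum (I : Type) (s : seq I) (F : I -> T -> R) :
  (forall i, nu.-integrable setT (EFin \o F i)) ->
  Rintegral nu setT (fun x => \sum_(i <- s) F i x) =
  \sum_(i <- s) Rintegral nu setT (F i).
Proof.
move=> Fi; elim: s => [|i s IH].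
  rewrite big_nil; under eq_Rintegral do rewrite big_nil.
  by rewrite Rintegral_cst// mul0r.
rewrite big_cons -IH -RintegralD//.
  by apply: eq_Rintegral => x _; rewrite big_cons.
rewrite (_ : _ \o _ = fun x => \sum_(j <- s) (F j x)%:E)%E.
  by apply: integrable_sum => // j _; exact: Fi.
by apply/funext => x; rewrite /= sumEFin.
Qed.

End square_integrable.

Section probability_square_integrable.
Context d (T : measurableType d) (R : realType) (mu : probability T R).

Lemma L2_cst (c : R) : L2 mu (cst c).
Proof.
split=> //; apply: (eq_integrable _ (EFin \o cst (c ^+ 2))) => //.
exact: finite_measure_integrable_cst.
Qed.

Lemma L2_integrable (f : T -> R) : L2 mu f -> mu.-integrable setT (EFin \o f).
Proof.
move=> Lf; apply: (eq_integrable _ _ _ _ (L2M_integrable Lf (L2_cst 1))) => //.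
by move=> x _ /=; rewrite mulr1.
Qed.

Lemma ip_cst1 (f : T -> R) : ip mu f (cst 1) = Rintegral mu setT f.
Proof. by apply: eq_Rintegral => x _; rewrite /= mulr1. Qed.

End probability_square_integrable.

Section reversible_kernel.
Context d (T : measurableType d) (R : realType).
Variables (mu : probability T R) (P : R.-pker T ~> T).
Hypothesis reversible : forall B C : set T, measurable B -> measurable C ->
  (\int[mu]_(x in B) P x C = \int[mu]_(x in C) P x B)%E.

Local Notation M := (joint mu P).

Lemma joint_swap (S : set (T * T)) : measurable S -> M (unstable.swap @^-1` S) = M S.
Proof.
move=> mS; have mswap := @measurable_swap _ _ T T.
pose N : {measure set (T * T) -> \bar R} :=
  measure_function_pushforward__canonical__measure_function_Measure M mswap.
pose G := [set A `*` B | A in @measurable _ T & B in @measurable _ T].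
have mG : @measurable _ (T * T)%type = <<s G >> by exact: measurable_prod_measurableType.
have GI : setI_closed G.
  move=> _ _ [A mA [B mB <-]] [C mC [D mD <-]].
  by exists (A `&` C); [exact: measurableI|exists (B `&` D); [exact: measurableI|rewrite setXI]].
have GT : forall i : nat, G setT by exists setT => //; exists setT => //; rewrite setXTT.
have covT : \bigcup_(i : nat) [set: T * T] = setT by rewrite bigcup_const.
have NM B : G B -> N B = M B.
  move=> [A mA [C mC <-]]; transitivity (M (C `*` A)); last by rewrite !joint_setX// reversible.
  by rewrite /N; congr (M _); apply/seteqP; split=> -[x y] [].
apply: (measure_unique G (fun=> setT) mG GI GT covT N M NM _ S mS) => _.
rewrite (NM _ (GT 0%N)) -setXTT joint_setX//; under eq_integral do rewrite prob_kernel.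
by rewrite integral_cst// mul1e [ltLHS]probability_setT ltry.
Qed.

Lemma integral_joint_swap (F : T * T -> \bar R) : measurable_fun setT F ->
  (\int[M]_z F (unstable.swap z) = \int[M]_z F z)%E.
Proof.
have ge0 (H : T * T -> \bar R) : measurable_fun setT H -> (forall z, 0 <= H z)%E ->
    (\int[M]_z H (unstable.swap z) = \int[M]_z H z)%E.
  move=> mH H0.
  have H0' : {in setT, forall z : T * T, (0 <= H z)%E} by move=> z _.
  have := ge0_integral_pushforward (@measurable_swap _ _ T T) M measurableT mH H0'.
  rewrite preimage_setT => <-.
  apply: eq_measure_integral; first exact: measurable_swap.
  by move=> ? A mA _; exact: joint_swap.
move=> mF; rewrite [LHS]integralE [RHS]integralE; congr (_ - _)%E.
  rewrite -(ge0 _ (measurable_funepos mF))//.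
  by apply: eq_integral => z _; rewrite !funeposE.
rewrite -(ge0 _ (measurable_funeneg mF))//.
by apply: eq_integral => z _; rewrite !funenegE.
Qed.

Lemma Rintegral_joint_swap (F : T * T -> R) : measurable_fun setT F ->
  Rintegral M setT (fun z => F (unstable.swap z)) = Rintegral M setT F.
Proof.
move=> mF; congr fine; apply: (integral_joint_swap (F := EFin \o F)).
exact/measurable_EFinP.
Qed.

Lemma L2_fst (f : T -> R) : L2 mu f -> L2 M (fun z => f z.1).
Proof.
move=> [mf f2]; split; first exact: measurableT_comp.
exact: (integrable_joint_fst P (F := fun x => (f x ^+ 2)%:E)).
Qed.

Lemma L2_snd (f : T -> R) : L2 mu f -> L2 M (fun z => f z.2).
Proof.
move=> Lf; have [mf _] := Lf; split; first exact: measurableT_comp.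
have [_ /integrableP[mf1 f1]] := L2_fst Lf.
apply/integrableP; split.
  by apply/measurable_EFinP; apply: measurable_funX; exact: measurableT_comp.
rewrite -integral_joint_swap in f1; first exact: f1.
exact: measurableT_comp.
Qed.

Lemma ip_fst (f g : T -> R) : L2 mu f -> L2 mu g ->
  ip M (fun z => f z.1) (fun z => g z.1) = ip mu f g.
Proof.
move=> [mf _] [mg _]; congr fine.
apply: (integral_joint_fst mu P (F := fun x => (f x * g x)%:E)).
by apply/measurable_EFinP; exact: measurable_funM.
Qed.

Lemma ip_swap (F G : T * T -> R) : measurable_fun setT F -> measurable_fun setT G ->
  ip M (fun z => F (unstable.swap z)) (fun z => G (unstable.swap z)) = ip M F G.
Proof.
move=> mF mG; rewrite /ip -(Rintegral_joint_swap (F := fun z => F z * G z))//.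
exact: measurable_funM.
Qed.

Definition kform (f g : T -> R) : R := ip M (fun z => f z.1) (fun z => g z.2).

Lemma kformC f g : L2 mu f -> L2 mu g -> kform f g = kform g f.
Proof.
move=> [mf _] [mg _]; rewrite /kform ipC.
rewrite -(ip_swap (F := fun z => g z.1) (G := fun z => f z.2))//; exact: measurableT_comp.
Qed.

Lemma kform_sqD f g (a b : R) : L2 mu f -> L2 mu g ->
  let u x := a * f x + b * g x in
  kform u u = a ^+ 2 * kform f f + 2 * a * b * kform f g + b ^+ 2 * kform g g.
Proof.
move=> Lf Lg u; rewrite /kform /u.
have [f1 f2 g1 g2] : [/\ L2 M (fun z => f z.1), L2 M (fun z => f z.2),
    L2 M (fun z => g z.1) & L2 M (fun z => g z.2)].
  by split; [exact: L2_fst|exact: L2_snd|exact: L2_fst|exact: L2_snd].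
rewrite (ipDl _ _ f1 g1) ?(ipDr _ _ f2 g2)//; last exact: (L2D a b f2 g2).
rewrite -!/(kform _ _) (kformC Lg Lf); ring.
Qed.

Lemma ip_Kop f g : L2 mu f -> L2 mu g -> ip mu f (Kop P g) = kform f g.
Proof.
move=> Lf Lg; have fgi := L2M_integrable (L2_fst Lf) (L2_snd Lg).
have [mf _] := Lf; have [mg _] := Lg.
rewrite /kform /ip Rintegral_joint//; congr fine.
apply: ae_eq_integral => //.
- apply/measurable_EFinP; apply: measurable_funM => //; apply: measurable_Kop => //.
  by move=> U mU; exact: measurable_kernel.
- apply/measurable_EFinP.
  exact/measurable_EFinP/(measurable_int _ (integrable_Rintegral_inner fgi)).
- have gi : M.-integrable setT (fun z => (g z.2)%:E).
    have := L2M_integrable (L2_snd Lg) (L2_fst (L2_cst mu 1)).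
    by under eq_fun do rewrite mulr1.
  apply: filterS (integrable_inner gi) => x gx _.
  by congr EFin; apply/esym; exact: (RintegralZl (f x) measurableT gx).
Qed.

End reversible_kernel.

Section restriction.
Context d (T : measurableType d) (R : realType).
Variables (mu : probability T R) (P : R.-pker T ~> T).
Hypothesis reversible : forall B C : set T, measurable B -> measurable C ->
  (\int[mu]_(x in B) P x C = \int[mu]_(x in C) P x B)%E.

Local Notation M := (joint mu P).

Lemma indic_sq (A : set T) x : \1_A x * \1_A x = \1_A x :> R.
Proof. by rewrite indicE; case: (x \in A); rewrite ?mulr1// mulr0. Qed.

Lemma ae_eq_integrable (f g : T -> R) : measurable_fun setT f ->
  mu.-integrable setT (EFin \o g) -> {ae mu, forall x, f x = g x} ->
  mu.-integrable setT (EFin \o f).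
Proof.
move=> mf /integrableP[mg goo] fg; apply/integrableP; split; first exact/measurable_EFinP.
rewrite (ae_eq_integral (fun x => `|(g x)%:E|%E))//.
- by apply: measurableT_comp => //; exact/measurable_EFinP.
- exact: measurableT_comp.
- by apply: filterS fg => x fgx _; rewrite /= fgx.
Qed.

Section block.
Variables (A : set T) (mA : measurable A).

Definition block_energy (f : T -> R) : R :=
  Rintegral M setT (fun z => \1_A z.1 * \1_A z.2 * (f z.1 - f z.2) ^+ 2).

Let diag (f : T -> R) (z : T * T) : R := f z.1 ^+ 2 * (\1_A z.1 * \1_A z.2).

Let m1 : measurable_fun setT (fun z : T * T => \1_A z.1 : R).
Proof. exact: measurableT_comp. Qed.

Let m2 : measurable_fun setT (fun z : T * T => \1_A z.2 : R).
Proof. exact: measurableT_comp. Qed.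

Let diag_integrable f : L2 mu f -> M.-integrable setT (EFin \o diag f).
Proof.
move=> Lf; have [mf1 f1] := L2_fst P Lf.
apply: (le_integrable _ _ _ f1) => //.
  apply/measurable_EFinP; apply: measurable_funM; first exact: measurable_funX.
  exact: measurable_funM.
move=> z _; have /andP[i0 i1] : 0 <= (\1_A z.1 * \1_A z.2 : R) <= 1.
  by rewrite !indicE; case: (_ \in _); case: (_ \in _); rewrite ?mulr1 ?mulr0 ?lexx ?ler01.
rewrite !abse_EFin lee_fin [leRHS]ger0_norm ?sqr_ge0//.
rewrite /diag ger0_norm; last by rewrite mulr_ge0 ?sqr_ge0.
by rewrite ler_piMr ?sqr_ge0.
Qed.

Lemma block_energyE f : L2 mu f ->
  2^-1 * block_energy f =
  Rintegral M setT (diag f) - kform mu P (fun x => f x * \1_A x) (fun x => f x * \1_A x).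
Proof.
move=> Lf; have Lg := L2M_indic mA Lf.
have Di := diag_integrable Lf.
have mD : measurable_fun setT (diag f) by apply/measurable_EFinP; exact: measurable_int Di.
have Si : M.-integrable setT (EFin \o (fun z => diag f (unstable.swap z))).
  apply/integrableP; split.
    apply/measurable_EFinP; apply: measurableT_comp => //; exact: measurable_swap.
  have /integrableP[mE] := Di.
  by rewrite -(integral_joint_swap reversible)//; exact: measurableT_comp.
have Gi := L2M_integrable (L2_fst P Lg) (L2_snd reversible Lg).
have S : block_energy f = Rintegral M setT (diag f) +
    (Rintegral M setT (diag f) +
     (- 2) * kform mu P (fun x => f x * \1_A x) (fun x => f x * \1_A x)).
  rewrite -{2}(Rintegral_joint_swap reversible mD) /kform /ip -RintegralZl// -RintegralD//.
    rewrite -RintegralD//; last first.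
      exact: (integrableD _ Si (integrableZl _ (- 2) Gi)).
    apply: eq_Rintegral => z _; rewrite /diag /unstable.swap /=; ring.
  exact: (integrableZl _ _ Gi).
by rewrite S; lra.
Qed.

Lemma L2_mu_restr f : L2 mu f -> L2 (mu_restr mu mA) f.
Proof.
move=> [mf f2]; split=> //; apply: integrable_mscale; apply: integrable_mrestr.
  exact: measurable_int f2.
exact: integrableS f2.
Qed.

Hypothesis muA : (0 < mu A)%E.

Lemma fine_mu_gt0 : 0 < fine (mu A).
Proof. by rewrite fine_gt0// muA/= ltey_eq fin_num_measure. Qed.

Lemma L2_of_mu_restr f : L2 (mu_restr mu mA) f -> L2 mu (fun x => f x * \1_A x).
Proof.
move=> [mf f2]; split; first exact: measurable_funM.
have mf2 : measurable_fun setT (fun x => (f x ^+ 2)%:E).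
  by apply/measurable_EFinP; exact: measurable_funX.
have fA : mu.-integrable A (fun x => (f x ^+ 2)%:E).
  move/integrableP : f2 => [_]; rewrite ge0_integral_mscale//; last exact: measurableT_comp.
  rewrite ge0_integral_mrestr//; last exact: measurableT_comp.
  move=> foo; apply/integrableP; split; first exact: measurable_funS mf2.
  rewrite ltey; apply: contraTneq foo => ->.
  by rewrite gt0_muley ?ltxx// lte_fin invr_gt0 normr_gt0 gt_eqF// fine_mu_gt0.
move/(integrable_mkcond _ mA) : fA; congr (_.-integrable _ _).
apply/funext => x; rewrite patchE exprMn indicE; case: ifP => _.
  by rewrite expr1n mulr1.
by rewrite expr0n mulr0.
Qed.

Lemma Rintegral_mu_restrM (f : T -> R) : measurable_fun setT f ->
  mu.-integrable setT (fun x => (f x * \1_A x)%:E) ->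
  fine (mu A) * Rintegral (mu_restr mu mA) setT f =
  Rintegral mu setT (fun x => f x * \1_A x).
Proof.
move=> mf fi; rewrite Rintegral_mu_restr//; last first.
  apply/(integrable_mkcond _ mA); move: fi; congr (_.-integrable _ _).
  apply/funext => x; rewrite patchE indicE; case: ifP => _ /=; first by rewrite mulr1.
  by rewrite mulr0.
rewrite ger0_norm ?fine_ge0// mulrA divff ?mul1r ?gt_eqF ?fine_mu_gt0//.
exact: Rintegral_indicM.
Qed.

Lemma ip_mu_restr (f : T -> R) : measurable_fun setT f -> L2 mu (fun x => f x * \1_A x) ->
  fine (mu A) * ip (mu_restr mu mA) f f =
  ip mu (fun x => f x * \1_A x) (fun x => f x * \1_A x).
Proof.
move=> mf Lg.
have E x : f x * f x * \1_A x = f x * \1_A x * (f x * \1_A x).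
  by rewrite mulrACA indic_sq.
rewrite /ip Rintegral_mu_restrM//; first by apply: eq_Rintegral => x _; exact: E.
  exact: measurable_funM.
by under eq_fun do rewrite E; exact: L2M_integrable.
Qed.

Lemma ip_Kop_restr f : L2 mu f ->
  fine (mu A) * ip (mu_restr mu mA) f (Kop (P_restr P mA) f) =
  kform mu P (fun x => f x * \1_A x) (fun x => f x * \1_A x) +
  ip mu (fun x => f x * \1_A x) (fun x => f x * \1_A x) - Rintegral M setT (diag f).
Proof.
move=> Lf; have [mf f2] := Lf; have Lg := L2M_indic mA Lf.
set g := fun x => f x * \1_A x.
have [mg _] := Lg.
pose G (z : T * T) := g z.1 * g z.2 + (g z.1 * g z.1 + (- 1) * diag f z).
have Di := diag_integrable Lf.
have g12 := L2M_integrable (L2_fst P Lg) (L2_snd reversible Lg).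
have g11 := L2M_integrable (L2_fst P Lg) (L2_fst P Lg).
have Ti : M.-integrable setT (EFin \o (fun z => g z.1 * g z.1 + (- 1) * diag f z)).
  exact: (integrableD _ g11 (integrableZl _ (- 1) Di)).
have Gi : M.-integrable setT (EFin \o G) by exact: (integrableD _ g12 Ti).
have fi : M.-integrable setT (fun z => (f z.2)%:E).
  have := L2M_integrable (L2_snd reversible Lf) (L2_fst P (L2_cst mu 1)).
  by under eq_fun do rewrite mulr1.
have mK : measurable_fun setT (fun x => f x * Kop (P_restr P mA) f x).
  apply: measurable_funM => //; apply: measurable_Kop => // U mU.
  exact: measurable_P_restr.
have aeE : {ae mu, forall x, f x * Kop (P_restr P mA) f x * \1_A x =
    Rintegral (P x) setT (fun y => G (x, y))}.
  apply: filterS (integrable_inner fi) => x fx.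
  have gx : (P x).-integrable setT (EFin \o g).
    apply: (le_integrable _ _ _ fx) => //; first exact/measurable_EFinP.
    move=> y _; rewrite /= lee_fin normrM ler_piMr//.
    by rewrite indicE; case: (_ \in _); rewrite ?normr1 ?normr0.
  have cx : (P x).-integrable setT (EFin \o (\1_(~` A) : T -> R)).
    apply: (@le_integrable _ _ _ _ _ _ _ (EFin \o cst 1)) => //.
    - exact/measurable_EFinP/measurable_indic/measurableC.
    - move=> y _; rewrite /= lee_fin normr1 indicE.
      by case: (y \in _); rewrite ?normr1 ?normr0 ?lexx ?ler01.
    - apply: measurable_bounded_integrable => //; last exact: bounded_cst.
      by rewrite [ltLHS]prob_kernel ltry.
  have cE : fine (P x (~` A)) = Rintegral (P x) setT (\1_(~` A)).
    by rewrite /Rintegral integral_indic ?setIT//; exact: measurableC.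
  rewrite Kop_P_restr// cE (Rintegral_indicM _ _ mA) -/g.
  transitivity (g x * Rintegral (P x) setT g +
      g x ^+ 2 * Rintegral (P x) setT (\1_(~` A))).
    move: (Rintegral (P x) setT g) (Rintegral (P x) setT _) => r r'.
    by rewrite /g indicE; case: (x \in A) => /=; ring.
  rewrite -!RintegralZl// -RintegralD//; first last.
  - exact: (integrableZl _ _ cx).
  - exact: (integrableZl _ _ gx).
  apply: eq_Rintegral => y _; rewrite /G /diag /g /= !indicE in_setC.
  by case: (x \in A); case: (y \in A) => /=; ring.
rewrite /ip Rintegral_mu_restrM//; last first.
  apply: (ae_eq_integrable _ (integrable_Rintegral_inner Gi) aeE).
  exact: measurable_funM.
transitivity (Rintegral M setT G).
  rewrite Rintegral_joint//; congr fine; apply: ae_eq_integral => //.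
  - by apply/measurable_EFinP; exact: measurable_funM.
  - exact: measurable_int (integrable_Rintegral_inner Gi).
  - by apply: filterS aeE => x -> _.
rewrite RintegralD// RintegralD//; last exact: (integrableZl _ (- 1) Di).
have := ip_fst P Lg Lg; rewrite RintegralZl// /kform /ip -/g => <-; lra.
Qed.

Lemma Dir_restr f : L2 mu f ->
  fine (mu A) * Dir (mu_restr mu mA) (P_restr P mA) f = 2^-1 * block_energy f.
Proof.
move=> Lf; have [mf _] := Lf.
rewrite /Dir mulrBr ip_mu_restr//; last exact: L2M_indic.
rewrite ip_Kop_restr// block_energyE//; lra.
Qed.

End block.

End restriction.

(* For a unit mean-zero near-minimiser f and its block projection h, these are
   a = (h, h), p = (h, P h), q = (f, P h) and e = (f, P f), while c is the gap
   of P. *)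
Lemma two_gap_ge (R : realFieldType) (m l c : R) :
  0 <= m <= 1 -> l <= 1 -> 0 <= c <= 1 ->
  (forall t, 0 < t <= 1 -> exists a p q e,
    [/\ 0 <= a <= 1, 0 <= p, p <= (1 - l) * a, c <= 1 - e <= c + t ^+ 2 &
     [/\ m * (1 - a) <= 1 - e,
         e - 2 * t * q + t ^+ 2 * p <= (1 - c) * (1 - 2 * t * a + t ^+ 2 * a)
       & 0 <= a ^+ 2 * e - 2 * a * q + p]]) ->
  m * l <= 2 * c.
Proof.
move=> /andP[m0 m1] l1 /andP[c0 c1] H.
have key t : 0 < t <= 1 -> m * l <= 2 * c + 3 * t.
  move=> /andP[t0 t1]; have [|a [p [q [e]]]] := H t; first by rewrite t0.
  move=> [/andP[a0 a1] p0 pa /andP[ec et] [gap_m gap_c psd]].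
  have b1 : (1 - c) * a <= 1 by nra.
  have qa : (1 - c) * a <= q + t.
    suff : t * ((1 - c) * a) <= t * (q + t) by rewrite ler_pM2l.
    have : 0 <= t ^+ 2 * (1 - (1 - c) * a) by rewrite mulr_ge0 ?sqr_ge0// subr_ge0.
    have : 0 <= t ^+ 2 * p by rewrite mulr_ge0 ?sqr_ge0.
    lra.
  have ba : (1 - c) * a <= 1 - l + 2 * t.
    move: a0; rewrite le_eqVlt => /predU1P[<-|a0]; first lra.
    have : 2 * q <= a * e + (1 - l).
      suff : a * (2 * q) <= a * (a * e + (1 - l)) by rewrite ler_pM2l.
      lra.
    have : a * e <= a * (1 - c) by rewrite ler_pM2l//; lra.
    lra.
  have : (1 - c) * (m * (1 - a)) <= (1 - c) * (c + t ^+ 2).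
    by apply: ler_wpM2l; [lra|exact: le_trans et].
  have : m * ((1 - c) * a) <= m * (1 - l + 2 * t) by exact: ler_wpM2l.
  have : m * t <= t by rewrite ler_piMl// ltW.
  have : c * m <= c by rewrite ler_piMr.
  have : (1 - c) * t ^+ 2 <= t.
    have : t ^+ 2 <= t by rewrite expr2 ler_piMl// ltW.
    have : 0 <= c * t ^+ 2 by rewrite mulr_ge0 ?sqr_ge0.
    lra.
  have : 0 <= c ^+ 2 by rewrite sqr_ge0.
  lra.
rewrite leNgt; apply/negP => lt_ml.
have d0 : 0 < m * l - 2 * c by rewrite subr_gt0.
have ml1 : m * l <= 1.
  have : m * l <= m by rewrite ler_piMr.
  lra.
have := key ((m * l - 2 * c) / 4).
by rewrite divr_gt0//= => /(_ _)/implyP; lra.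
Qed.

Section gap_bounds.
Context d (T : measurableType d) (R : realType).

Lemma Gap_le (nu : {measure set T -> \bar R}) (Q : T -> {measure set T -> \bar R})
    (f : T -> R) (r : R) :
  (r%:E <= Gap nu Q)%E -> 0 <= r -> L2 nu f -> 0 <= Dir nu Q f ->
  r * Var nu f <= Dir nu Q f.
Proof.
move=> rG r0 Lf D0; have [V0|V0] := leP (Var nu f) 0.
  by apply: le_trans D0; rewrite mulr_ge0_le0.
rewrite -ler_pdivlMr// -lee_fin; apply: le_trans rG _.
by apply: ereal_inf_lbound; exists f.
Qed.

Lemma GapF_le (J : nat) (w : 'I_J -> R) (Q : 'I_J -> 'I_J -> R) (g : 'I_J -> R) (r : R) :
  (r%:E <= GapF w Q)%E -> 0 <= r -> 0 <= DirF w Q g -> r * VarF w g <= DirF w Q g.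
Proof.
move=> rG r0 D0; have [V0|V0] := leP (VarF w g) 0.
  by apply: le_trans D0; rewrite mulr_ge0_le0.
rewrite -ler_pdivlMr// -lee_fin; apply: le_trans rG _.
by apply: ereal_inf_lbound; exists g.
Qed.

Lemma L2_sum (nu : {measure set T -> \bar R}) (I : Type) (s : seq I)
    (g : I -> R) (F : I -> T -> R) : (forall i, L2 nu (F i)) ->
  L2 nu (fun x => \sum_(i <- s) g i * F i x).
Proof.
move=> LF; elim: s => [|i s IH].
  under eq_fun do rewrite big_nil; split=> //.
  by under eq_fun do rewrite expr0n; exact: integrable0.
have := L2D (g i) 1 (LF i) IH; congr L2; apply/funext => x.
by rewrite big_cons mul1r.
Qed.

Lemma ip_suml (nu : {measure set T -> \bar R}) (I : Type) (s : seq I)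
    (g : I -> R) (F : I -> T -> R) (u : T -> R) :
  (forall i, L2 nu (F i)) -> L2 nu u ->
  ip nu (fun x => \sum_(i <- s) g i * F i x) u = \sum_(i <- s) g i * ip nu (F i) u.
Proof.
move=> LF Lu.
have Fi i := L2M_integrable (LF i) Lu.
transitivity (Rintegral nu setT (fun x => \sum_(i <- s) g i * (F i x * u x))).
  by apply: eq_Rintegral => x _; rewrite mulr_suml; apply: eq_bigr => i _; rewrite mulrA.
rewrite Rintegral_sum; last by move=> i; exact: (integrableZl _ (g i) (Fi i)).
by apply: eq_bigr => i _; rewrite RintegralZl//; exact: Fi.
Qed.

End gap_bounds.

Section dirichlet.
Context d (T : measurableType d) (R : realType).
Variables (mu : probability T R) (P : R.-pker T ~> T).
Hypothesis reversible : forall B C : set T, measurable B -> measurable C ->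
  (\int[mu]_(x in B) P x C = \int[mu]_(x in C) P x B)%E.

Local Notation M := (joint mu P).

Lemma DirE f : L2 mu f -> Dir mu P f = ip mu f f - kform mu P f f.
Proof. by move=> Lf; rewrite /Dir (ip_Kop reversible). Qed.

Lemma Dir_energy f : L2 mu f -> Dir mu P f = 2^-1 * block_energy mu P setT f.
Proof.
move=> Lf; rewrite (block_energyE reversible)// DirE//; congr (_ - _).
  rewrite -(ip_fst P Lf Lf); apply: eq_Rintegral => z _.
  by rewrite !indicT !mulr1 expr2.
by congr kform; apply/funext => x; rewrite indicT mulr1.
Qed.

Lemma Dir_ge0 f : L2 mu f -> 0 <= Dir mu P f.
Proof.
move=> Lf; rewrite Dir_energy// mulr_ge0 ?invr_ge0//; apply: Rintegral_ge0 => z _.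
by rewrite !indicT !mul1r sqr_ge0.
Qed.

Lemma Dir_affine f (a b : R) : L2 mu f ->
  Dir mu P (fun x => a * f x + b * cst 1 x) = a ^+ 2 * Dir mu P f.
Proof.
move=> Lf; have L1 := L2_cst mu 1.
rewrite !DirE//; last exact: L2D.
rewrite ip_sqD// (kform_sqD reversible)//.
have -> : kform mu P f (cst 1) = ip mu f (cst 1).
  by rewrite -(ip_fst P Lf L1).
have -> : kform mu P (cst 1) (cst 1) = ip mu (cst 1) (cst 1).
  by rewrite -(ip_fst P L1 L1).
ring.
Qed.

Lemma Rintegral_affine f (a b : R) : L2 mu f ->
  Rintegral mu setT (fun x => a * f x + b * cst 1 x) = a * Rintegral mu setT f + b.
Proof.
move=> Lf; have L1 := L2_cst mu 1.
rewrite -!ip_cst1 ipDl// !ip_cst1 Rintegral_cst//.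
by rewrite mul1r [X in fine X]probability_setT mulr1.
Qed.

Lemma Var_affine f (a b : R) : L2 mu f ->
  Var mu (fun x => a * f x + b * cst 1 x) = a ^+ 2 * Var mu f.
Proof.
move=> Lf; have L1 := L2_cst mu 1.
rewrite /Var Rintegral_affine// ip_sqD// !ip_cst1 Rintegral_cst//.
rewrite mul1r [X in fine X]probability_setT /=; ring.
Qed.

Lemma near_minimiser (c t : R) : 0 < t -> Gap mu P = c%:E ->
  exists u, [/\ L2 mu u, Rintegral mu setT u = 0, ip mu u u = 1 &
    Dir mu P u < c + t].
Proof.
move=> t0 Gc.
have /ereal_inf_lt[_ [f [Lf V0] <-]] : (Gap mu P < (c + t)%:E)%E.
  by rewrite Gc lte_fin ltrDl.
rewrite lte_fin => lt_ct.
pose s := (Num.sqrt (Var mu f))^-1.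
have s2 : s ^+ 2 = (Var mu f)^-1 by rewrite exprVn sqr_sqrtr// ltW.
pose b := - (s * Rintegral mu setT f).
exists (fun x => s * f x + b * cst 1 x).
have u0 : Rintegral mu setT (fun x => s * f x + b * cst 1 x) = 0.
  by rewrite Rintegral_affine// subrr.
split=> //; first by apply: L2D => //; exact: L2_cst.
- have := Var_affine s b Lf.
  by rewrite {1}/Var u0 expr0n subr0 s2 mulVf ?gt_eqF.
- by rewrite Dir_affine// s2 mulrC.
Qed.

Hypothesis psd : forall f : T -> R, L2 mu f -> 0 <= ip mu (Kop P f) f.

Lemma kform_ge0 f : L2 mu f -> 0 <= kform mu P f f.
Proof. by move=> Lf; rewrite -(ip_Kop reversible)// ipC psd. Qed.

Lemma Dir_le_Var f : L2 mu f -> Dir mu P f <= Var mu f.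
Proof.
move=> Lf; set c := Rintegral mu setT f.
have L0 : L2 mu (fun x => 1 * f x + (- c) * cst 1 x) by apply: L2D => //; exact: L2_cst.
rewrite -[leLHS]mul1r -[leRHS]mul1r -(expr1n _ 2) -(Dir_affine _ (- c))// -(Var_affine _ (- c))//.
rewrite DirE// /Var Rintegral_affine// mul1r -/c subrr expr0n subr0.
by rewrite gerBl kform_ge0.
Qed.

End dirichlet.

Section partition.
Context d (T : measurableType d) (R : realType).
Variables (mu : probability T R) (P : R.-pker T ~> T).
Hypothesis reversible : forall B C : set T, measurable B -> measurable C ->
  (\int[mu]_(x in B) P x C = \int[mu]_(x in C) P x B)%E.
Variables (J : nat) (A : 'I_J -> set T) (mA : forall j, measurable (A j)).
Hypothesis disjoint_blocks : forall i j : 'I_J, i != j -> A i `&` A j = set0.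
Hypothesis cover_blocks : \bigcup_(j in [set: 'I_J]) A j = [set: T].
Hypothesis muA : forall j, (0 < mu (A j))%E.

Local Notation M := (joint mu P).
Let w j := fine (mu (A j)).

Let w_gt0 j : 0 < w j. Proof. exact: fine_mu_gt0. Qed.

Lemma sum_blocks x (F : 'I_J -> R) j : A j x -> \sum_i F i * \1_(A i) x = F j.
Proof.
move=> Ax; rewrite (bigD1 j)//= big1 ?addr0.
  by rewrite indicE mem_set// mulr1.
move=> i ij; rewrite indicE memNset ?mulr0// => Aix.
by have : (A i `&` A j) x by []; rewrite disjoint_blocks.
Qed.

Lemma block_of x : exists j, A j x.
Proof. by have : [set: T] x by []; rewrite -cover_blocks => -[j _ Ax]; exists j. Qed.

Definition step (g : 'I_J -> R) (x : T) : R := \sum_j g j * \1_(A j) x.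

Let L2_block j : L2 mu (\1_(A j) : T -> R).
Proof.
have := L2M_indic (mA j) (L2_cst mu 1); congr L2.
by apply/funext => x; rewrite mul1r.
Qed.

Lemma L2_step g : L2 mu (step g).
Proof. exact: L2_sum. Qed.

Let ip_block i j : ip mu (\1_(A i)) (\1_(A j)) = (i == j)%:R * w j.
Proof.
have [->|ij] := eqVneq i j.
  rewrite mul1r /ip; under eq_Rintegral do rewrite indic_sq.
  by rewrite /Rintegral integral_indic// setIT.
rewrite mul0r /ip (@eq_Rintegral _ _ _ _ _ (cst 0)) ?Rintegral_cst ?mul0r// => x _.
rewrite !indicE; have [xi|] := boolP (x \in A i); last by rewrite mul0r.
have [xj|] := boolP (x \in A j); last by rewrite mulr0.
have : (A i `&` A j) x by split; exact: set_mem.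
by rewrite disjoint_blocks.
Qed.

Lemma ip_step g f : L2 mu f -> ip mu (step g) f = \sum_j g j * ip mu (\1_(A j)) f.
Proof. by move=> Lf; exact: ip_suml. Qed.

Lemma ip_block_step j g : ip mu (\1_(A j)) (step g) = w j * g j.
Proof.
rewrite ipC ip_step//; under eq_bigr do rewrite ip_block.
rewrite (bigD1 j)//= big1 ?addr0; last by move=> i /negbTE->; rewrite mul0r mulr0.
by rewrite eqxx mul1r mulrC.
Qed.

Lemma ip_step_step g : ip mu (step g) (step g) = \sum_j w j * g j ^+ 2.
Proof.
rewrite ip_step; last exact: L2_step.
by apply: eq_bigr => j _; rewrite ip_block_step; ring.
Qed.

Lemma Rintegral_step g : Rintegral mu setT (step g) = \sum_j w j * g j.
Proof.
rewrite -ip_cst1 ip_step; last exact: L2_cst.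
apply: eq_bigr => j _; rewrite ip_cst1 mulrC; congr (_ * _).
by rewrite /Rintegral integral_indic// setIT.
Qed.

Lemma Var_step g : Var mu (step g) = VarF w g.
Proof. by rewrite /Var ip_step_step Rintegral_step. Qed.

Lemma kform_block i j : kform mu P (\1_(A i)) (\1_(A j)) = w i * Pbar mu P A i j.
Proof.
transitivity (fine (M (A i `*` A j))); last first.
  by rewrite joint_setX// /Pbar mulrC divfK// gt_eqF// w_gt0.
rewrite /kform /ip (_ : (fun z => _) = \1_(A i `*` A j)).
  by rewrite /Rintegral integral_indic ?setIT//; exact: measurableX.
apply/funext => z; rewrite !indicE in_setX.
by case: (_ \in _); case: (_ \in _); rewrite /= ?mulr1 ?mulr0.
Qed.

Lemma kform_step g : kform mu P (step g) (step g) =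
  \sum_i \sum_j w i * Pbar mu P A i j * g i * g j.
Proof.
rewrite /kform /step.
rewrite (ip_suml _ g (F := fun i z => \1_(A i) z.1)); last 2 first.
- by move=> i; exact: (L2_fst P (L2_block i)).
- exact: (L2_snd reversible (L2_step g)).
apply: eq_bigr => i _; rewrite ipC.
rewrite (ip_suml _ g (F := fun i z => \1_(A i) z.2)); last 2 first.
- by move=> j; exact: (L2_snd reversible (L2_block j)).
- exact: (L2_fst P (L2_block i)).
rewrite mulr_sumr; apply: eq_bigr => j _.
by rewrite ipC -/(kform mu P (\1_(A i)) (\1_(A j))) kform_block; ring.
Qed.

Lemma Dir_step g : Dir mu P (step g) = DirF w (Pbar mu P A) g.
Proof. by rewrite DirE//; [rewrite ip_step_step kform_step|exact: L2_step]. Qed.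

Definition block_mean (f : T -> R) (j : 'I_J) : R := ip mu (\1_(A j)) f / w j.

Definition projection (f : T -> R) : T -> R := step (block_mean f).

Lemma L2_projection f : L2 mu (projection f).
Proof. exact: L2_step. Qed.

Lemma ip_projection f : L2 mu f ->
  ip mu f (projection f) = ip mu (projection f) (projection f).
Proof.
move=> Lf; rewrite ip_step_step ipC ip_step//; apply: eq_bigr => j _.
have wj : w j != 0 by rewrite gt_eqF.
by rewrite /block_mean; field.
Qed.

Lemma sum_ip_blocks f : L2 mu f ->
  \sum_j ip mu (fun x => f x * \1_(A j) x) (fun x => f x * \1_(A j) x) = ip mu f f.
Proof.
move=> Lf; rewrite -(Rintegral_sum _ (F := fun j x => f x * \1_(A j) x * (f x * \1_(A j) x))).
  apply: eq_Rintegral => x _; have [j Ajx] := block_of x.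
  rewrite -[RHS](sum_blocks (fun=> f x * f x) Ajx); apply: eq_bigr => i _.
  by rewrite mulrACA indic_sq.
by move=> j; apply: L2M_integrable; exact: L2M_indic.
Qed.

Lemma Var_restr j (f : T -> R) : measurable_fun setT f ->
  L2 mu (fun x => f x * \1_(A j) x) ->
  w j * Var (mu_restr mu (mA j)) f =
  ip mu (fun x => f x * \1_(A j) x) (fun x => f x * \1_(A j) x) -
  (Rintegral mu setT (fun x => f x * \1_(A j) x)) ^+ 2 / w j.
Proof.
move=> mf Lf; rewrite /Var mulrBr ip_mu_restr//; congr (_ - _).
rewrite -(Rintegral_mu_restrM (mA j) (muA j) mf (L2_integrable Lf)) -/(w j).
have wj : w j != 0 by rewrite gt_eqF.
by field.
Qed.

Lemma sum_Var_restr f : L2 mu f -> \sum_j w j * Var (mu_restr mu (mA j)) f =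
  ip mu f f - ip mu (projection f) (projection f).
Proof.
move=> Lf; have [mf _] := Lf.
rewrite ip_step_step -(sum_ip_blocks Lf) -sumrB; apply: eq_bigr => j _.
rewrite Var_restr//; last exact: L2M_indic.
congr (_ - _); rewrite /block_mean ipC /ip.
have wj : w j != 0 by rewrite gt_eqF.
by field.
Qed.

Let block_integrable j f : L2 mu f -> M.-integrable setT
  (EFin \o (fun z => \1_(A j) z.1 * \1_(A j) z.2 * (f z.1 - f z.2) ^+ 2)).
Proof.
move=> Lf.
have LF := L2D 1 (- 1) (L2_fst P Lf) (L2_snd reversible Lf).
have [_] := L2M_indic (measurableX (mA j) (mA j)) LF.
congr (_.-integrable _ _); apply/funext => z; congr EFin.
rewrite mul1r mulN1r !indicE in_setX.
by case: (_ \in _); case: (_ \in _); rewrite /= ?(mulr1, mulr0, mul1r, mul0r) ?expr0n.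
Qed.

Let energy_integrable f : L2 mu f -> M.-integrable setT
  (EFin \o (fun z => \1_setT z.1 * \1_setT z.2 * (f z.1 - f z.2) ^+ 2)).
Proof.
move=> Lf.
have [_] := L2D 1 (- 1) (L2_fst P Lf) (L2_snd reversible Lf).
congr (_.-integrable _ _); apply/funext => z; congr EFin.
by rewrite !indicT !mul1r mulN1r.
Qed.

Lemma sum_Dir_restr_le f : L2 mu f ->
  \sum_j w j * Dir (mu_restr mu (mA j)) (P_restr P (mA j)) f <= Dir mu P f.
Proof.
move=> Lf; rewrite (Dir_energy reversible)//.
under eq_bigr do rewrite (Dir_restr reversible)//.
rewrite -mulr_sumr ler_pM2l ?invr_gt0//.
rewrite -(Rintegral_sum _ (fun j => block_integrable j Lf)).
apply: le_Rintegral => //.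
- have := integrable_sum measurableT (index_enum 'I_J) (P := xpredT)
    (fun j _ => block_integrable j Lf).
  by under eq_fun do rewrite sumEFin.
- exact: energy_integrable.
move=> z _; have [j Ajz] := block_of z.1.
rewrite -mulr_suml !indicT !mul1r ler_piMl ?sqr_ge0//.
under eq_bigr do rewrite mulrC.
rewrite (sum_blocks (fun i => \1_(A i) z.2) Ajz) indicE.
by case: (_ \in _).
Qed.

Lemma block_gap_le m f : 0 <= m ->
  (forall j, (m%:E <= Gap (mu_restr mu (mA j)) (P_restr P (mA j)))%E) -> L2 mu f ->
  m * (ip mu f f - ip mu (projection f) (projection f)) <= Dir mu P f.
Proof.
move=> m0 mG Lf; apply: le_trans (sum_Dir_restr_le Lf).
rewrite -sum_Var_restr// mulr_sumr; apply: ler_sum => j _.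
rewrite mulrCA ler_pM2l//; apply: Gap_le => //; first exact: L2_mu_restr.
rewrite -(pmulr_rge0 _ (w_gt0 j)) (Dir_restr reversible)// mulr_ge0 ?invr_ge0//.
by apply: Rintegral_ge0 => z _; rewrite mulr_ge0 ?sqr_ge0// mulr_ge0.
Qed.

Lemma sum_weights : \sum_j w j = 1.
Proof.
transitivity (Rintegral mu setT (step (fun=> 1))).
  by rewrite Rintegral_step; apply: eq_bigr => j _; rewrite mulr1.
transitivity (Rintegral mu setT (cst 1)).
  apply: eq_Rintegral => x _; have [j Ajx] := block_of x.
  exact: (sum_blocks (fun=> 1) Ajx).
by rewrite Rintegral_cst// mul1r [X in fine X]probability_setT.
Qed.

Lemma Rintegral_projection f : L2 mu f ->
  Rintegral mu setT (projection f) = Rintegral mu setT f.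
Proof.
move=> Lf; rewrite Rintegral_step -ip_cst1 ipC.
transitivity (ip mu (step (fun=> 1)) f).
  rewrite ip_step//; apply: eq_bigr => j _.
  by rewrite /block_mean mulrC divfK ?gt_eqF// mul1r.
apply: eq_Rintegral => x _; have [j Ajx] := block_of x.
by rewrite /step (sum_blocks (fun=> 1) Ajx).
Qed.

Lemma VarF_gt0 : (1 < J)%N -> exists g, 0 < VarF w g.
Proof.
move=> J1; pose i0 : 'I_J := Ordinal (ltnW J1); pose i1 : 'I_J := Ordinal J1.
exists (fun j => (j == i0)%:R).
have S (h : R -> R) : h 0 = 0 -> \sum_j w j * h (j == i0)%:R = w i0 * h 1.
  move=> h0; rewrite (bigD1 i0)//= ?eqxx big1 ?addr0// => j /negbTE->.
  by rewrite h0 mulr0.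
rewrite /VarF (S (fun y => y ^+ 2)) ?expr0n// (S id)// expr1n mulr1.
have : w i0 < 1.
  rewrite -sum_weights (bigD1 i0)//= ltrDl (bigD1 i1)//= ltr_wpDr//.
  by apply: sumr_ge0 => j _; exact/ltW.
have := w_gt0 i0; nra.
Qed.

Hypothesis psd : forall f : T -> R, L2 mu f -> 0 <= ip mu (Kop P f) f.

Lemma block_gap_le1 m j : 0 <= m ->
  (forall i, (m%:E <= Gap (mu_restr mu (mA i)) (P_restr P (mA i)))%E) ->
  (Gap (mu_restr mu (mA j)) (P_restr P (mA j)) < +oo)%E -> m <= 1.
Proof.
move=> m0 mG /ereal_inf_lt[_ [f [Lf Vf] _] _].
have [mf _] := Lf; have Lg := L2_of_mu_restr (muA j) Lf.
have wj : w j != 0 by rewrite gt_eqF.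
set g := fun x => f x * \1_(A j) x in Lg.
pose b := Rintegral mu setT g / w j.
pose u x := 1 * g x + (- b) * \1_(A j) x.
have Lu : L2 mu u by exact: L2D.
have gj : ip mu g (\1_(A j)) = Rintegral mu setT g.
  by apply: eq_Rintegral => x _; rewrite /g -mulrA indic_sq.
have u_off i : ip mu (\1_(A i)) u = 0.
  have [->|ij] := eqVneq i j.
    by rewrite ipC ipDl// gj ip_block eqxx !mul1r /b mulNr divfK// subrr.
  rewrite /ip (@eq_Rintegral _ _ _ _ _ (cst 0)) ?Rintegral_cst ?mul0r// => x _.
  rewrite /u /g !indicE; have [xi|] := boolP (x \in A i); last by rewrite mul0r.
  have [xj|] := boolP (x \in A j); last by rewrite !mulr0 addr0 mulr0.
  have : (A i `&` A j) x by split; exact: set_mem.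
  by rewrite disjoint_blocks.
have proj_u : ip mu (projection u) (projection u) = 0.
  rewrite ip_step_step big1// => i _.
  by rewrite /block_mean u_off mul0r expr0n mulr0.
have uu : 0 < ip mu u u.
  have : 0 < w j * Var (mu_restr mu (mA j)) f by exact: mulr_gt0.
  rewrite Var_restr// -/g ip_sqD// gj ip_block eqxx mul1r.
  suff -> : ip mu g g - Rintegral mu setT g ^+ 2 / w j =
    1 ^+ 2 * ip mu g g + 2 * 1 * - b * Rintegral mu setT g + (- b) ^+ 2 * w j by [].
  by rewrite /b; field.
have := block_gap_le m0 mG Lu.
rewrite proj_u subr0 (DirE reversible)// => mu_le.
rewrite -(ler_pM2r uu) mul1r; apply: le_trans mu_le _.
by rewrite gerBl (kform_ge0 reversible psd).
Qed.


Lemma gap_product_le (m l c : R) : 0 <= m <= 1 -> 0 <= l <= 1 -> 0 <= c <= 1 ->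
  (forall j, (m%:E <= Gap (mu_restr mu (mA j)) (P_restr P (mA j)))%E) ->
  (l%:E <= GapF w (Pbar mu P A))%E -> Gap mu P = c%:E -> m * l <= 2 * c.
Proof.
move=> /andP[m0 m1] /andP[l0 l1] /andP[c0 c1] mG lG Gc.
apply: two_gap_ge; rewrite ?m0 ?m1 ?c0 ?c1// => t /andP[t0 t1].
have [|u [Lu u0 u1 Du]] := near_minimiser reversible (t := t ^+ 2) _ Gc.
  by rewrite exprn_gt0.
pose h := projection u.
have Lh : L2 mu h := L2_projection u.
have uh : ip mu u h = ip mu h h := ip_projection Lu.
have h0 : Rintegral mu setT h = 0 by rewrite Rintegral_projection.
have cG : (c%:E <= Gap mu P)%E by rewrite Gc.
have hh0 : 0 <= ip mu h h by apply: Rintegral_ge0 => x _; rewrite -expr2 sqr_ge0.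
have hh1 : ip mu h h <= 1.
  have : 0 <= ip mu (fun x => 1 * u x + (- 1) * h x) (fun x => 1 * u x + (- 1) * h x).
    by apply: Rintegral_ge0 => x _; rewrite -expr2 sqr_ge0.
  by rewrite ip_sqD// uh u1; lra.
exists (ip mu h h), (kform mu P h h), (kform mu P u h), (kform mu P u u); split.
- by rewrite hh0.
- exact: (kform_ge0 reversible psd).
- have Dh : 0 <= DirF w (Pbar mu P A) (block_mean u).
    by rewrite -Dir_step; exact: (Dir_ge0 reversible).
  have := GapF_le lG l0 Dh.
  rewrite -Dir_step -Var_step -/h (DirE reversible)// /Var h0; lra.
- have := Gap_le cG c0 Lu (Dir_ge0 reversible Lu).
  move: Du; rewrite (DirE reversible)// /Var u0 u1 => /ltW Du; rewrite expr0n subr0 mulr1 => ->.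
  exact: Du.
split.
- have := block_gap_le m0 mG Lu.
  by rewrite (DirE reversible)// u1.
- have Lv : L2 mu (fun x => 1 * u x + (- t) * h x) by exact: L2D.
  have := Gap_le cG c0 Lv (Dir_ge0 reversible Lv).
  have v0 : Rintegral mu setT (fun x => 1 * u x + (- t) * h x) = 0.
    rewrite -ip_cst1 ipDl//; last exact: L2_cst.
    by rewrite !ip_cst1 u0 h0 !mulr0 addr0.
  rewrite /Var v0 (DirE reversible)// (kform_sqD reversible)// ip_sqD// uh u1.
  lra.
- have Lv : L2 mu (fun x => ip mu h h * u x + (- 1) * h x) by exact: L2D.
  by have := kform_ge0 reversible psd Lv; rewrite (kform_sqD reversible)//; lra.
Qed.

End partition.

Theorem theorem5p2 (d : measure_display) (T : measurableType d) (R : realType)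
  (mu : probability T R) (P : R.-pker T ~> T)
  (J : nat) (A : 'I_J -> set T) (mA : forall j, measurable (A j)) :
  countably_generated T ->
  (* reversibility: mu(dx) P(x,dy) = mu(dy) P(y,dx) *)
  (forall B C : set T, measurable B -> measurable C ->
     (\int[mu]_(x in B) P x C = \int[mu]_(x in C) P x B)%E) ->
  (* nonnegative definiteness *)
  (forall f : T -> R, L2 mu f -> 0 <= ip mu (Kop P f) f) ->
  (* {A_1,...,A_J} is a partition of the state space *)
  (forall i j : 'I_J, i != j -> A i `&` A j = set0) ->
  \bigcup_(j in [set: 'I_J]) A j = [set: T] ->
  (forall j, (0 < mu (A j))%E) ->
  (* non-degeneracy (see NOTES.md, FIDELITY) *)
  (1 < J)%N ->
  (exists j, (Gap (mu_restr mu (mA j)) (P_restr P (mA j)) < +oo)%E) ->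
  let gbar := GapF (fun j => fine (mu (A j))) (Pbar mu P A) in
  let gmin := \big[Order.min/+oo%E]_(j < J) Gap (mu_restr mu (mA j)) (P_restr P (mA j)) in
  ((2^-1)%:E * gbar * gmin <= Gap mu P)%E /\ (Gap mu P <= gbar)%E.
Proof.
move=> _ reversible psd disjoint_blocks cover_blocks muA J1 [j Gj] gbar gmin.
have upper : (Gap mu P <= gbar)%E.
  apply: le_ereal_inf_tmp => _ [g Vg <-].
  rewrite -(Dir_step reversible)// -(Var_step mu)//.
  apply: ereal_inf_lbound; exists (step A g) => //; split; first exact: L2_step.
  by rewrite Var_step.
split=> //.
have Gap0 : (0 <= Gap mu P)%E.
  apply: le_ereal_inf_tmp => _ [f [Lf Vf] <-].
  by rewrite lee_fin divr_ge0 ?(ltW Vf)// (Dir_ge0 reversible).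
have [g Vg] := VarF_gt0 mA disjoint_blocks cover_blocks muA J1.
have gbar1 : (gbar <= 1)%E.
  apply: ge_ereal_inf; exists (DirF (fun i => fine (mu (A i))) (Pbar mu P A) g /
    VarF (fun i => fine (mu (A i))) g)%:E; first by exists g.
  rewrite lee_fin ler_pdivrMr// mul1r -(Dir_step reversible)// -(Var_step mu)//.
  by apply: (Dir_le_Var reversible psd); exact: L2_step.
have gbar_fin : gbar \is a fin_num.
  by rewrite ge0_fin_numE ?(le_lt_trans gbar1) ?ltry// (le_trans Gap0).
have Gap_fin : Gap mu P \is a fin_num.
  by rewrite ge0_fin_numE// (le_lt_trans upper) ?(le_lt_trans gbar1) ?ltry.
have half_gbar0 : (0 <= (2^-1)%:E * gbar)%E.
  by rewrite mule_ge0 ?lee_fin ?invr_ge0// (le_trans Gap0).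
have gmin_le i : (gmin <= Gap (mu_restr mu (mA i)) (P_restr P (mA i)))%E.
  exact: bigmin_le.
have := le_lt_trans (gmin_le j) Gj; case Em : gmin => [m| |]// _; last first.
  by apply: le_trans Gap0; rewrite mule_ge0_le0.
have [m0|m_lt0] := leP 0 m; last first.
  by apply: le_trans Gap0; rewrite mule_ge0_le0// lee_fin ltW.
have mG i : (m%:E <= Gap (mu_restr mu (mA i)) (P_restr P (mA i)))%E by rewrite -Em.
have m1 : m <= 1.
  exact: (block_gap_le1 reversible disjoint_blocks cover_blocks muA psd m0 mG Gj).
have gbarE : gbar = (fine gbar)%:E by rewrite fineK.
have GapE : Gap mu P = (fine (Gap mu P))%:E by rewrite fineK.
have l0 : 0 <= fine gbar by rewrite fine_ge0// (le_trans Gap0).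
have l1 : fine gbar <= 1 by rewrite -lee_fin -gbarE.
have c0 : 0 <= fine (Gap mu P) by rewrite fine_ge0.
have c1 : fine (Gap mu P) <= 1 by rewrite -lee_fin -GapE (le_trans upper).
rewrite gbarE GapE -!EFinM lee_fin -mulrA ler_pdivrMl// mulrC.
apply: (gap_product_le reversible disjoint_blocks cover_blocks muA psd _ _ _ mG _ GapE).
- by rewrite m0.
- by rewrite l0.
- by rewrite c0.
- by rewrite -gbarE.
Qed.
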